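(* Let $H$ be an infinite-dimensional separable complex Hilbert space, let $\mathcal{A}=\mathcal{B}(H)$ be the algebra of all bounded linear operators on $H$, and let $f\in\mathbb{C}\langle\mathcal{X}\rangle$ be a nonconstant polynomial. Then every operator in $\mathcal{A}$ is a sum of eight or fewer operators from $f(\mathcal{A})$.
   Context: $\mathbb{C}\langle\mathcal{X}\rangle$ is the free unital associative algebra over $\mathbb{C}$ generated by $\mathcal{X}=\{X_1,X_2,\dots\}$; its elements are called (noncommutative) polynomials. For $f=f(X_1,\dots,X_m)$ and a $\mathbb{C}$-algebra $\mathcal{A}$, the image of $f$ is $f(\mathcal{A})=\{f(a_1,\dots,a_m)\mid a_1,\dots,a_m\in\mathcal{A}\}$. *)

(* Defs.v *)
From HB Require Import structures.
From mathcomp Require Import all_boot all_order all_algebra.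
From mathcomp Require Import finmap sesquilinear complex.
From mathcomp Require Import all_classical all_reals all_analysis.
(* without its notations, which are incompatible with those of the analysis
   library *)
From mathcomp.multinomials Require Import (canonicals, coercions) monalg.

Set Implicit Arguments.
Unset Strict Implicit.
Unset Printing Implicit Defensive.

Import Order.TTheory GRing.Theory Num.Theory Num.Def.
Import numFieldNormedType.Exports.

Local Open Scope classical_set_scope.
Local Open Scope complex_scope.
Local Open Scope ring_scope.

(* The field of complex numbers is R[i], for R : realType. The norm of a normed
   module over R[i] is R[i]-valued (with nonnegative real values), and norms are
   compared using the partial order of R[i]. The inner product is linear in its
   first argument and conjugate-linear in the second one. *)
HB.mixin Record CompleteNormedModule_isHilbert (R : realType) H
    of CompleteNormedModule R[i] H := {
  inner : {dot H for conjC};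
  innerE : forall x : H, inner x x = `|x| ^+ 2
}.

#[short(type="hilbertType")]
HB.structure Definition Hilbert (R : realType) :=
  {H of CompleteNormedModule R[i] H & CompleteNormedModule_isHilbert R H}.

Definition separable (T : topologicalType) :=
  exists2 D : set T, countable D & dense D.

Definition finite_dimensional (K : fieldType) (V : lmodType K) :=
  exists s : seq V, forall x, exists c : 'I_(size s) -> K,
    x = \sum_(i < size s) c i *: s`_i.

Section BoundedOperators.
Context {R : realType} {H : hilbertType R}.
Implicit Types (S T U : H -> H).

Definition bounded_operator : {pred H -> H} := fun T =>
  `[< linear T /\ exists M : R[i], forall x, `|T x| <= M * `|x| >].

Lemma bounded_operatorP T :
  reflect (linear T /\ exists M : R[i], forall x, `|T x| <= M * `|x|)
          (T \in bounded_operator).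
Proof. by rewrite unfold_in; exact: asboolP. Qed.

Lemma bounded_operator_submod_closed : subsemimod_closed bounded_operator.
Proof.
split; first split.
- apply/bounded_operatorP; split=> [a x y|]; first by rewrite scaler0 addr0.
  by exists 0 => x; rewrite normr0 mul0r.
- move=> S T /bounded_operatorP[linS [M SM]] /bounded_operatorP[linT [N TN]].
  apply/bounded_operatorP; split=> [a x y|].
    by rewrite !fctE linS linT scalerDr addrACA.
  exists (M + N) => x; rewrite !fctE mulrDl.
  by rewrite (le_trans (ler_normD _ _))// lerD.
- move=> a T /bounded_operatorP[linT [M TM]].
  apply/bounded_operatorP; split=> [b x y|].
    by rewrite !fctE linT scalerDr !scalerA mulrC.
  by exists (`|a| * M) => x; rewrite !fctE normrZ -mulrA ler_wpM2l.
Qed.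

Lemma bounded_operator_id : idfun \in bounded_operator.
Proof. by apply/bounded_operatorP; split=> //; exists 1 => x; rewrite mul1r. Qed.

Lemma bounded_operator_comp S T :
  S \in bounded_operator -> T \in bounded_operator ->
  S \o T \in bounded_operator.
Proof.
move=> /bounded_operatorP[linS [M SM]] /bounded_operatorP[linT [N TN]].
apply/bounded_operatorP; split=> [a x y|]; first by rewrite /= linT linS.
exists (`|M| * N) => x /=; rewrite -mulrA.
have [Tx0|Tx0] := eqVneq (T x) 0.
  rewrite (le_trans (SM _))// Tx0 normr0 mulr0 mulr_ge0//.
  exact: le_trans (TN x).
have M0 : 0 <= M.
  rewrite -(pmulr_lge0 _ (_ : 0 < `|T x|)) ?normr_gt0//.
  exact: le_trans (SM _).
by rewrite (le_trans (SM _))// ger0_norm// ler_wpM2l.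
Qed.

End BoundedOperators.

Record bop (R : realType) (H : hilbertType R) := Bop {
  bop_fun :> H -> H;
  bop_subproof : bop_fun \in bounded_operator
}.

Section BoundedOperatorAlgebra.
Context (R : realType) (H : hilbertType R).
Implicit Types (S T U : bop H).

HB.instance Definition _ := [isSub for @bop_fun R H].
HB.instance Definition _ := [Choice of bop H by <:].
HB.instance Definition _ :=
  GRing.SubChoice_isSubLmodule.Build _ _ _ (bop H) bounded_operator_submod_closed.

Definition bop_one : bop H := Bop bounded_operator_id.

Definition bop_mul S T : bop H :=
  Bop (bounded_operator_comp (bop_subproof S) (bop_subproof T)).

Let bopP S T : S =1 T -> S = T.
Proof. by move=> ST; apply/val_inj/funext. Qed.

Let bop_mulA : associative bop_mul. Proof. by move=> S T U; exact: bopP. Qed.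
Let bop_mul1l : left_id bop_one bop_mul. Proof. by move=> S; exact: bopP. Qed.
Let bop_mul1r : right_id bop_one bop_mul. Proof. by move=> S; exact: bopP. Qed.

Let bop_mulDl : left_distributive bop_mul +%R.
Proof. by move=> S T U; exact: bopP. Qed.

Let bop_mulDr : right_distributive bop_mul +%R.
Proof.
move=> S T U; apply: bopP => x /=.
have /bounded_operatorP[linS _] := bop_subproof S.
by have := linS 1 (T x) (U x); rewrite !scale1r.
Qed.

(* An algType is required to satisfy 1 != 0, which fails for H = 0. *)
HB.instance Definition _ := GRing.Zmodule_isPzRing.Build (bop H)
  bop_mulA bop_mul1l bop_mul1r bop_mulDl bop_mulDr.

Lemma bop_scalerAl (a : R[i]) S T : a *: (S * T) = (a *: S) * T.
Proof. exact: bopP. Qed.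

Lemma bop_scalerAr (a : R[i]) S T : a *: (S * T) = S * (a *: T).
Proof.
apply: bopP => x /=.
have /bounded_operatorP[linS _] := bop_subproof S.
have S0 : S 0 = 0 by have := linS (-1) 0 0; rewrite scaler0 addr0 scaleN1r addNr.
by have := linS a (T x) 0; rewrite !addr0 S0 addr0.
Qed.

End BoundedOperatorAlgebra.

(* The free algebra C<X_1, X_2, ...>, as the algebra over C of the free monoid
   on nat: the index i stands for the variable X_(i+1), and a word in the
   variables is a monomial. *)
Definition ncpoly (R : realType) := monalg.malg (monalg.fmonom nat) R[i].

Definition nonconstant (R : realType) (f : ncpoly R) :=
  forall c : R[i], f <> monalg.mkmalgU (monalg.one : monalg.fmonom nat) c.

Section Evaluation.
Context (R : realType) (H : hilbertType R).
Implicit Types (f : ncpoly R) (a : nat -> bop H).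

Definition nceval f a : bop H :=
  \sum_(w <- monalg.msupp f)
    monalg.mcoeff w f *: \prod_(i <- monalg.fmonom_val w) a i.

(* Only finitely many of the values a i are used: those for which the variable
   occurs in f. *)
Definition ncimage f : set (bop H) := range (nceval f).

End Evaluation.

(* Main.v *)
Require Import Defs.
From mathcomp Require Import all_boot all_order all_algebra complex.
From mathcomp Require Import finmap sesquilinear.
From mathcomp Require Import all_classical all_reals all_analysis.
From mathcomp.multinomials Require Import (canonicals, coercions) monalg.

(* Let [w] be a shortest nonempty word of [f]. Evaluating each variable at the
   sum of the edges carrying its name along a path of matrix units labelled by
   [w] kills every other nonempty word of [f]. Hence the constant term of [f]
   plus any square-zero operator [p q] that leaves an infinite-dimensional room
   (to hold the inner vertices of the path) is a value of [f], and it suffices to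
   write every operator as a sum of eight such square-zero operators. Split [H]
   into five copies of itself. An operator with zero diagonal blocks is a sum of
   five of them, and three more give the diagonal any prescribed value: each of
   these has blocks [x_i y_i] with [sum_i y_i x_i = 0], so the only obstruction
   is the sum [D] of the diagonal blocks, which is absorbed by the infinite
   direct sum [E = D + D + ...], as [E] minus its shift is a single copy of [D]. *)

Set Implicit Arguments.
Unset Strict Implicit.
Unset Printing Implicit Defensive.

Import Order.TTheory GRing.Theory Num.Theory Num.Def.
Import numFieldNormedType.Exports.

Local Open Scope classical_set_scope.
Local Open Scope complex_scope.
Local Open Scope ring_scope.

(** * Square-zero elements with room *)

Section RoomySquareZero.
Context {A : pzRingType}.
Implicit Types (N T D E : A).

(* [p'] and [q'] embed a copy of the whole space that [p q] does not touch. *)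
Definition roomy N := exists p q p' q' : A,
  [/\ N = p * q, q * p = 0, q' * p' = 1, q' * p = 0 & q * p' = 0].

Definition matrix_units n (w w' : 'I_n -> A) :=
  (forall i j, w' i * w j = (i == j)%:R) /\ \sum_i w i * w' i = 1.

(* [v] and [s] are complementary isometries, with left inverses [u] and [t]. *)
Definition splitting (u v s t : A) :=
  [/\ u * v = 1, t * s = 1, u * s = 0, t * v = 0 & v * u + s * t = 1].

Section Splitting.
Context {u v s t : A}.
Context (uvst : splitting u v s t).

(** Induction keeps the copy [v] of the space as one block and moves the previous blocks into its
    complement by [s]. Each block is thus a copy of the whole space, so that block entries lie in
    [A] again. *)
Lemma matrix_units_exist n : exists w w' : 'I_n.+1 -> A, matrix_units w w'.
Proof.
have [uv ts us tv vust] := uvst.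
elim: n => [|n [w [w' [w'w ww']]]].
  exists (fun=> 1), (fun=> 1); split => [i j|]; last by rewrite big_ord1 mulr1.
  by rewrite !ord1 eqxx mulr1.
exists (fun i => if unlift ord0 i is Some j then s * w j else v).
exists (fun i => if unlift ord0 i is Some j then w' j * t else u).
split=> [i j|].
  case: (unliftP ord0 i) => [i' ->|->]; case: (unliftP ord0 j) => [j' ->|->].
  - by rewrite (inj_eq lift_inj) -w'w mulrA -(mulrA _ t) ts mulr1.
  - by rewrite -mulrA tv mulr0.
  - by rewrite mulrA us mul0r.
  - by rewrite uv.
rewrite big_ord_recl unlift_none; under eq_bigr do rewrite liftK mulrA -(mulrA s).
by rewrite -mulr_suml -mulr_sumr ww' mulr1.
Qed.

Lemma expr_splittingK k : t ^+ k * s ^+ k = 1.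
Proof.
have [uv ts us tv vust] := uvst.
elim: k => [|k IHk]; first by rewrite mulr1.
by rewrite exprSr exprS mulrA -(mulrA _ t) ts mulr1.
Qed.

(** The [s ^+ k * v] embed infinitely many independent copies of the space, from which the inner
    vertices of the path are taken. *)
Lemma splitting_orth j k : u * t ^+ j * (s ^+ k * v) = (j == k)%:R.
Proof.
have [uv ts us tv vust] := uvst.
have [jk|kj|->] := ltngtP j k.
- rewrite -(subnKC jk) addSnnS exprD -!mulrA (mulrA (t ^+ j)) expr_splittingK.
  by rewrite mul1r exprS !mulrA us !mul0r.
- rewrite -(subnK kj) -addSnnS exprD -!mulrA (mulrA (t ^+ k)) expr_splittingK.
  by rewrite mul1r exprSr -!mulrA tv !mulr0.
- by rewrite -!mulrA (mulrA (t ^+ k)) expr_splittingK mul1r.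
Qed.
End Splitting.

(** * Diagonal and off-diagonal blocks *)

Section FiveBlocks.
Context {w w' : 'I_5 -> A}.
Context (ww : matrix_units w w').

(** With the column [p] of the [x i] and the row [q] of the [y i], the first hypothesis says
    [q * p = 0], and the empty block [j] is the room. *)
Lemma roomy_diagonal (x y : 'I_5 -> A) j :
  \sum_i y i * x i = 0 -> x j = 0 -> y j = 0 ->
  exists N, roomy N /\ forall i, w' i * N * w i = x i * y i.
Proof.
case: ww => w'w ww' yx xj yj.
set p := \sum_i w i * x i; set q := \sum_i y i * w' i.
have w'p i : w' i * p = x i.
  rewrite mulr_sumr (bigD1 i)//= mulrA w'w eqxx mul1r big1 ?addr0// => k ki.
  by rewrite mulrA w'w eq_sym (negPf ki) mul0r.
have qw i : q * w i = y i.
  rewrite mulr_suml (bigD1 i)//= -mulrA w'w eqxx mulr1 big1 ?addr0// => k ki.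
  by rewrite -mulrA w'w (negPf ki) mulr0.
exists (p * q); split; last by move=> i; rewrite mulrA w'p -mulrA qw.
exists p, q, (w j), (w' j); split=> //; last by rewrite qw.
- by rewrite mulr_suml -[RHS]yx; apply: eq_bigr => i _; rewrite -mulrA w'p.
- by rewrite w'w eqxx.
- by rewrite w'p.
Qed.

(* The summand [c] keeps the rows [c - 1, c + 1] and the columns [c - 2, c + 2],
   so that block [c] is left over: every ordered pair of distinct blocks, seen
   as elements of Z/5, belongs to exactly one summand. *)
Lemma roomy_off_diagonal M : (forall i, w' i * M * w i = 0) ->
  exists N : 'I_5 -> A, (forall c, roomy (N c)) /\ M = \sum_c N c.
Proof.
case: ww => w'w ww' M0; pose e i := w i * w' i.
have ew i j : i != j -> e i * w j = 0.
  by move=> ij; rewrite -mulrA w'w (negPf ij) mulr0.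
have we i j : i != j -> w' i * e j = 0.
  by move=> ij; rewrite mulrA w'w (negPf ij) mul0r.
have ee i j : i != j -> e i * e j = 0 by move=> ij; rewrite mulrA ew ?mul0r.
exists (fun c =>
  (e (c + 1) + e (c - 1)) * (M * (e (c + 2%:R) + e (c - 2%:R)))).
split=> [c|].
  exists (e (c + 1) + e (c - 1)), (M * (e (c + 2%:R) + e (c - 2%:R))).
  exists (w c), (w' c).
  have sh a b : (a != b) -> c + a != c + b by move=> ab; apply: contra_neq ab => /addrI.
  have sh0 a : (a != 0) -> c + a != c by move=> a0; rewrite -[X in _ != X]addr0 sh.
  split=> //.
  - by rewrite -mulrA mulrDl !mulrDr !ee ?sh// mulr0 !addr0.
  - by rewrite w'w eqxx.
  - by rewrite mulrDr !we 1?eq_sym ?sh0 ?addr0//.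
  - by rewrite -mulrA mulrDl !ew ?sh0// addr0 mulr0.
have shift a b : \sum_(c : 'I_5) e (c + a) * (M * e (c + b))
    = \sum_c e c * (M * e (c + (b - a))).
  rewrite [RHS](reindex_inj (addIr a)) /=; apply: eq_bigr => c _.
  by rewrite -addrA (addrC a) subrK.
under [RHS]eq_bigr do rewrite mulrDl !mulrDr.
rewrite !big_split /= !shift -!big_split /=.
rewrite -[LHS]mul1r -ww' mulr_suml; apply: eq_bigr => i _.
have sum5 (F : 'I_5 -> A) :
    \sum_j F j = F 0 + (F 1 + (F (2%:R) + (F (- 2%:R) + F (- 1)))).
  rewrite !big_ord_recl big_ord0 addr0.
  by do ![congr (_ + _)]; congr F; apply: val_inj.
(* The column-minus-row offsets are the four nonzero elements of Z/5, each occurring once. *)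
have [-> -> -> ->] : [/\ 2%:R - 1 = 1 :> 'I_5, - 2%:R - 1 = 2%:R :> 'I_5,
    2%:R - - 1 = - 2%:R :> 'I_5 & - 2%:R - - 1 = - 1 :> 'I_5].
  by split; apply: val_inj.
rewrite -[in LHS](mulr1 M) -{1}ww' (reindex_inj (addrI i)) /= sum5 !mulrDr addr0.
have -> : w i * w' i * (M * (w i * w' i)) = 0.
  by rewrite -!mulrA (mulrA M) (mulrA (w' i)) (mulrA (w' i)) M0 mul0r mulr0.
by rewrite add0r !addrA.
Qed.
End FiveBlocks.

Lemma sum_eight_roomy u v s t : splitting u v s t ->
    (forall D, exists E, E = v * D * u + s * E * t) ->
  forall T, exists N : 'I_8 -> A, (forall k, roomy (N k)) /\ T = \sum_k N k.
Proof.
move=> uvst swindle T; have [uv ts us tv vust] := uvst.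
have [w [w' ww]] := matrix_units_exist uvst 4.
pose d (i : nat) := w' (inord i) * T * w (inord i).
pose S := d 1 + d 2 + d 3 + d 4.
have [E EE] := swindle (d 0 + S).
(* [N3] reduces the diagonal to [(0, d1 - S, d2 + v (d0 + S) u, d3, d4)], whose
   sum [v (d0 + S) u = E - s E t] is then matched by [N1 + N2], which has
   [s E t - s E t = 0] in block 0. *)
have [|//|//|N3 [rN3 dN3]] := @roomy_diagonal w w' ww
    (fun i => [:: 1; 1; - v * (d 0 + S); 0; 0]`_i)
    (fun i => [:: d 0; S; u; 0; 0]`_i) (inord 3); rewrite ?inordK//.
  rewrite !big_ord_recl big_ord0 /= !mulr0 !addr0 !mulr1.
  by rewrite addrA mulrA mulrN uv mulN1r subrr.
(* In block 0 the order of the factors matters: [x 0 * y 0] is [- s * E * t], but [y 0 * x 0] is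
   [- E] since [t * s = 1]. *)
have [|//|//|N2 [rN2 dN2]] := @roomy_diagonal w w' ww
    (fun i => [:: - s; 1; 0; 0; 1]`_i)
    (fun i => [:: E * t; E - d 4; 0; 0; d 4]`_i) (inord 3); rewrite ?inordK//.
  rewrite !big_ord_recl big_ord0 /= !mulr0 !addr0 !add0r !mulr1.
  by rewrite subrK mulrN -mulrA ts mulr1 addNr.
have [|//|//|N1 [rN1 dN1]] := @roomy_diagonal w w' ww
    (fun i => [:: 1; 1; 1; 1; 0]`_i)
    (fun i => [:: s * E * t; d 1 - S - E + d 4; d 2 + v * (d 0 + S) * u; d 3;
                  0]`_i)
    (inord 4); rewrite ?inordK//.
  rewrite !big_ord_recl big_ord0 /= !mulr1 mulr0 !addr0.
  set z := v * _ * u in EE *; rewrite !addrA.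
  (* The grouping forms [z + s * E * t], which is [E], and the sum of [d 1] to [d 4], which is
     [S]. *)
  rewrite (ACl ((7*1)*(2*6*8*5)*3*4))%AC /= -EE -/S.
  by rewrite addrK subrr.
clearbody S.
have [|N4 [rN4 N4E]] := @roomy_off_diagonal w w' ww (T - (N1 + N2 + N3)).
  move=> i; rewrite mulrBr mulrBl !mulrDr !mulrDl dN1 dN2 dN3 {dN1 dN2 dN3}.
  have -> : w' i * T * w i = d i by rewrite /d inord_val.
  apply/eqP; rewrite subr_eq0 eq_sym; apply/eqP.
  case: i => -[|[|[|[|[|//]]]]] _ /=; rewrite ?(mulr1, mul1r, mul0r, addr0, add0r)//.
  - by rewrite mulNr mulrA subrr add0r.
  - by rewrite addrA [_ + d 4 + E]addrAC addrK !subrK.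
  - by rewrite !mulNr addrK.
exists (fun k => match @fintype.split 3 5 k with
  | inl i => [:: N1; N2; N3]`_i | inr c => N4 c end).
split=> [k|]; first by case: splitP => // -[[|[|[|//]]]].
rewrite (@big_split_ord _ _ _ 3 5) /= -[LHS](subrK (N1 + N2 + N3)) N4E [LHS]addrC.
congr (_ + _); last first.
  by apply: eq_bigr => c _; rewrite -[rshift 3 c]/(unsplit (inr c)) unsplitK.
rewrite !big_ord_recl big_ord0 addr0 -addrA.
by do ![congr (_ + _)]; rewrite -[lshift 5 _]/(unsplit (inl _)) unsplitK.
Qed.
End RoomySquareZero.

(** * Values of polynomials *)

Section WordProduct.
Context (A : pzRingType) (I : eqType).
Implicit Types (p r : nat -> A) (w : seq I).

(* The variable [i] gets the sum of the edges [p k * r k] with label [i] of a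
   path labelled by [w0]. *)
Definition word_values w0 p r (i : I) : A :=
  \sum_(k < size w0 | onth w0 k == Some i) p k * r k.

(** Edge [p k * r k] can be followed only by edge [k.+1]: no edge leads back to the start [p 0], and
    none continues the last one. *)
Definition chain n p r :=
  forall k j, (k < n)%N -> (j < n)%N -> r k * p j = (j == k.+1)%:R.

(** After edge [k] the only way on is edge [k.+1], so [w] has to spell the labels that come next on
    the path. *)
Lemma chain_prod w0 p r w k : chain (size w0) p r -> (k < size w0)%N ->
  r k * \prod_(i <- w) word_values w0 p r i
  = if prefix w (drop k.+1 w0) then r (k + size w)%N else 0.
Proof.
move=> pr; elim: w k => [|i w IHw] k k0.
  by rewrite big_nil mulr1 addn0 prefix0s.
rewrite big_cons mulrA /word_values mulr_sumr.
have [w0k|kw0] := leqP (size w0) k.+1.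
  rewrite drop_oversize//= big1 ?mul0r// => j _.
  by rewrite mulrA pr// ltn_eqF ?mul0r// (leq_trans (ltn_ord j)).
have [x xE] : exists x, onth w0 k.+1 = Some x.
  by move: kw0; rewrite -onthTE; case: onth => // x _; exists x.
have -> : drop k.+1 w0 = x :: drop k.+2 w0.
  by rewrite (drop_nth x kw0); congr (_ :: _); exact: onth_nth xE.
rewrite /= eq_sym addnS -addSn.
under eq_bigr => j _ do rewrite mulrA pr//.
case: eqVneq => [xi|xi] /=.
  rewrite (bigD1 (Ordinal kw0)) /=; last by apply/eqP; rewrite -xi -xE.
  rewrite eqxx mul1r big1 ?addr0 ?IHw// => j /andP[_ jk].
  by rewrite (_ : (j == k.+1 :> nat) = false) ?mul0r//; apply: negbTE.
rewrite big1 ?mul0r// => j /eqP ji; case: eqVneq => [jk|_]; last by rewrite mul0r.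
by move: ji; rewrite jk xE => -[/eqP]; rewrite (negPf xi).
Qed.

(** A word this long fits on the path only by starting at edge 0 and traversing all of it. Shorter
    words could survive on a piece of the path, whence the choice of a shortest word of [f]. *)
Lemma word_values_prod w0 p r w : chain (size w0) p r -> w != [::] ->
  (size w0 <= size w)%N ->
  \prod_(i <- w) word_values w0 p r i
  = if w == w0 then p 0 * r (size w0).-1 else 0.
Proof.
case: w => // i w pr _.
case: w0 pr => [|x w0] pr w0w.
  by rewrite big_cons /word_values big_ord0 mul0r.
rewrite big_cons {1}/word_values mulr_suml big_mkcond big_ord_recl /=.
rewrite -mulrA chain_prod//= drop0 add0n big1 => [|k _].
  rewrite addr0 eqseq_cons (eq_sym i) -[Some x == Some i]/(x == i).
  case: eqP => //= _; rewrite prefixE take_oversize// (eq_sym w).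
  by case: eqP => [->|_]; rewrite ?mulr0.
case: ifP => // _; rewrite -mulrA chain_prod//= ?ltnS//.
case: ifP => [/size_prefix|_]; last by rewrite mulr0.
have w00 : (0 < size w0)%N by exact: leq_ltn_trans (ltn_ord k).
by rewrite size_drop leqNgt (@leq_trans (size w0))// ltn_subrL.
Qed.
End WordProduct.

Lemma nonconstant_word (R : realType) (f : ncpoly R) : nonconstant f ->
  exists2 w, w \in monalg.msupp f & monalg.fmonom_val w != [::].
Proof.
move=> f_nc; apply: contrapT => no_word.
apply: (f_nc (monalg.mcoeff monalg.one f)); apply/monalg.malgP => w.
rewrite monalg.mcoeffU; case: eqVneq => [<-|w1]; first by rewrite mulr1n.
rewrite monalg.mcoeff_outdom//; apply/negP => wf; apply: no_word.
exists w => //; apply: contra_neq w1 => w0.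
by apply: val_inj; rewrite /= monalg.fm1 w0.
Qed.

Lemma shortest_word (R : realType) (f : ncpoly R) : nonconstant f ->
  exists w, [/\ w \in monalg.msupp f, monalg.fmonom_val w != [::] &
    forall w', w' \in monalg.msupp f -> monalg.fmonom_val w' != [::] ->
      (size (monalg.fmonom_val w) <= size (monalg.fmonom_val w'))%N].
Proof.
move=> /nonconstant_word[w0 w0f w0_neq0].
pose P n := has (fun w => (monalg.fmonom_val w != [::])
                          && (size (monalg.fmonom_val w) == n)) (monalg.msupp f).
have exP : exists n, P n.
  by exists (size (monalg.fmonom_val w0)); apply/hasP; exists w0 => //; rewrite w0_neq0 /=.
case: (ex_minnP exP) => n /hasP[w wf /andP[w_neq0 /eqP <-]] minw.
exists w; split=> // w' w'f w'_neq0; apply: minw.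
by apply/hasP; exists w' => //; rewrite w'_neq0 /=.
Qed.

(** Here [w0] may lie outside the support, as the empty word does when the constant term is zero;
    both sides then vanish. *)
Lemma sum_msupp1 (R : realType) (H : hilbertType R) (f : ncpoly R) w0 (B : bop H) :
  \sum_(w <- monalg.msupp f) (if w == w0 then monalg.mcoeff w f *: B else 0)
  = monalg.mcoeff w0 f *: B.
Proof.
have [w0f|w0f] := boolP (w0 \in monalg.msupp f).
  rewrite (bigD1_seq w0)//= eqxx big1 ?addr0// => w /negPf ->//.
rewrite big1_seq => [|w /= wf]; first by rewrite monalg.mcoeff_outdom// scale0r.
by case: eqVneq => // ww0; rewrite -ww0 wf in w0f.
Qed.

Lemma ncimage_roomy (R : realType) (H : hilbertType R) (f : ncpoly R)
    (u v s t N : bop H) :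
  splitting u v s t -> nonconstant f -> roomy N ->
  ncimage f (monalg.mcoeff monalg.one f *: (1 : bop H) + N).
Proof.
move=> uvst /shortest_word[w0 [w0f w0_neq0 w0min]].
move=> [p [q [p' [q' [-> qp q'p' q'p qp']]]]].
set l := size (monalg.fmonom_val w0); set a := monalg.mcoeff w0 f.
have a0 : a != 0 by rewrite monalg.mcoeff_neq0.
(* The path starts at [p], ends at [q] and has its inner vertices in the room of [p * q]; the factor
   [a^-1] cancels the coefficient of [w0]. *)
pose P k := if k is 0 then p else p' * (s ^+ k * v).
pose Q k := if (k.+1 < l)%N then u * t ^+ k.+1 * q' else a^-1 *: q.
have chPQ : chain l P Q.
  move=> k j kl jl; rewrite /Q; case: ltnP => [k1l|lk].
    case: j jl => [|j] jl /=; first by rewrite -(mulrA _ q') q'p mulr0.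
    by rewrite -(mulrA _ q') (mulrA q') q'p' mul1r (splitting_orth uvst) eq_sym.
  rewrite -bop_scalerAl (ltn_eqF (leq_trans jl lk)).
  by case: j jl => [|j] jl /=; rewrite ?qp ?mulrA ?qp' ?mul0r scaler0.
exists (word_values (monalg.fmonom_val w0) P Q) => //.
(* Both terms of the target become sums over the support, to be compared with the value of [f] word
   by word. *)
rewrite /nceval -(sum_msupp1 f monalg.one 1).
have -> : p * q = a *: (P 0%N * Q l.-1).
  rewrite /Q /P prednK ?ltnn; last by rewrite lt0n size_eq0.
  by rewrite -bop_scalerAr scalerA divff// scale1r.
rewrite -sum_msupp1 -big_split /=; apply: eq_big_seq => w wf.
have [->|w1] := eqVneq w monalg.one.
  rewrite monalg.fm1 big_nil.
  case: eqVneq => [w01|_]; last by rewrite addr0.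
  by rewrite -w01 monalg.fm1 in w0_neq0.
have w_neq0 : monalg.fmonom_val w != [::].
  by apply: contra_neq w1 => w0E; apply: val_inj; rewrite /= monalg.fm1 w0E.
rewrite add0r (word_values_prod chPQ)// ?w0min//.
rewrite (inj_eq val_inj); case: eqP => //; by rewrite scaler0.
Qed.

(** * Orthonormal bases *)

Section Hilbert.
Context {R : realType} {H : hilbertType R}.
Local Notation C := R[i].
Implicit Types (x y : H) (e : nat -> H) (c : nat -> C).

Local Notation "''[' x , y ]" := (inner x y).
Local Notation "''[' x ]" := (inner x x).

Lemma innerC x y : '[x, y] = ('[y, x])^*%R.
Proof. by rewrite hermC /= mul1r. Qed.

Definition orthonormal_below e n :=
  forall i j, (i < n)%N -> (j < n)%N -> '[e i, e j] = (i == j)%:R.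

Definition proj_below e n x := \sum_(k < n) '[x, e k] *: e k.

Lemma inner_lincomb e n c j : orthonormal_below e n -> (j < n)%N ->
  '[\sum_(k < n) c k *: e k, e j] = c j.
Proof.
move=> e_on jn; rewrite linear_sumlz (bigD1 (Ordinal jn))//= linearZl_LR /=.
rewrite e_on// eqxx mulr1 big1 ?addr0// => i ij; rewrite linearZl_LR /= e_on//.
by rewrite (_ : (i == j :> nat) = false) ?mulr0//; apply: negbTE.
Qed.

Lemma dnorm_lincomb e n c : orthonormal_below e n ->
  '[\sum_(k < n) c k *: e k] = \sum_(k < n) `|c k| ^+ 2.
Proof.
move=> e_on; rewrite [LHS]linear_sumr /=; apply: eq_bigr => j _.
by rewrite linearZr_LR /= inner_lincomb// normCK mulrC.
Qed.

Lemma inner_residual e n x j : orthonormal_below e n -> (j < n)%N ->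
  '[x - proj_below e n x, e j] = 0.
Proof.
by move=> e_on jn; rewrite linearBl /= (inner_lincomb (fun k => '[x, e k]))// subrr.
Qed.

Lemma pythagoras e n x : orthonormal_below e n ->
  '[x] = \sum_(k < n) `|'[x, e k]| ^+ 2 + '[x - proj_below e n x].
Proof.
move=> e_on; rewrite -(dnorm_lincomb (fun k => '[x, e k]) e_on) -hnormDd /= ?subrKC//.
rewrite linear_sumlz /= big1// => k _; rewrite linearZl_LR /= (innerC (e k)).
by rewrite inner_residual// rmorph0 mulr0.
Qed.

Lemma bessel e n x : orthonormal_below e n ->
  \sum_(k < n) `|'[x, e k]| ^+ 2 <= '[x].
Proof. by move=> e_on; rewrite (pythagoras x e_on) lerDl dnorm_ge0. Qed.

Lemma dnorm_residual_le e n x : orthonormal_below e n ->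
  '[x - proj_below e n x] <= '[x].
Proof.
by move=> e_on; rewrite [leRHS](pythagoras x e_on) lerDr sumr_ge0// => k _; rewrite exprn_ge0.
Qed.

Lemma proj_belowB e n x y :
  proj_below e n (x - y) = proj_below e n x - proj_below e n y.
Proof.
rewrite /proj_below -sumrB; apply: eq_bigr => k _.
by rewrite linearBl /= scalerBl.
Qed.

Lemma dense_dnorm_lt (D : set H) x eps : dense D -> 0 < eps ->
  exists2 y, D y & '[x - y] < eps.
Proof.
move=> denseD eps0; have [||y [xy Dy]] := denseD (ball x (sqrtC eps)).
- by exists x; apply: ballxx; rewrite sqrtC_gt0.
- exact: ball_open.
exists y => //; rewrite innerE -[eps]sqrtCK ltrXn2r ?nnegrE ?sqrtC_ge0 ?(ltW eps0)//.
by move: xy; rewrite -ball_normE.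
Qed.

Lemma dnorm_residual_dist e n x y : orthonormal_below e n ->
  y - proj_below e n y = 0 -> '[x - proj_below e n x] <= '[x - y].
Proof.
move=> e_on y0.
have -> : x - proj_below e n x = (x - y) - proj_below e n (x - y).
  by rewrite proj_belowB -[LHS]subr0 -y0 !opprB !addrA (ACl (1*4*3*2))%AC.
exact: dnorm_residual_le.
Qed.

(** This is the closedness of a finite-dimensional span, in terms of distances. *)
Lemma dense_residual e n (D : set H) x : orthonormal_below e n -> dense D ->
  (forall y, D y -> y - proj_below e n y = 0) -> x - proj_below e n x = 0.
Proof.
move=> e_on denseD D0; apply/eqP; rewrite -(dnorm_eq0 inner) /=.
apply/eqP/le_anti; rewrite dnorm_ge0 andbT.
apply/ler_addgt0Pr => eps eps0; rewrite add0r.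
have [y Dy /ltW] := dense_dnorm_lt x denseD eps0.
by apply: le_trans; apply: dnorm_residual_dist; rewrite ?D0.
Qed.

Lemma eq_proj_below e e' n x : (forall k, (k < n)%N -> e k = e' k) ->
  proj_below e n x = proj_below e' n x.
Proof. by move=> ee'; apply: eq_bigr => k _; rewrite ee'. Qed.

Lemma proj_belowS e n x :
  proj_below e n.+1 x = proj_below e n x + '[x, e n] *: e n.
Proof. by rewrite /proj_below big_ord_recr. Qed.

Lemma orthonormal_belowS e n : orthonormal_below e n ->
  (forall j, (j < n)%N -> '[e n, e j] = 0) -> '[e n] = 1 ->
  orthonormal_below e n.+1.
Proof.
move=> e_on enj enn i j; rewrite !ltnS leq_eqVlt => /predU1P[->|ilt];
  rewrite leq_eqVlt => /predU1P[->|jlt]; first by rewrite enn eqxx mulr1n.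
- by rewrite (enj _ jlt) gtn_eqF ?mulr0n.
- by rewrite innerC (enj _ ilt) rmorph0 ltn_eqF ?mulr0n.
- exact: e_on.
Qed.

(** Gram-Schmidt along the enumeration [f] of [D]: each step normalizes the residual of the element
    of least index outside the current span, so [n] steps exhaust the indices below [n]. *)
Lemma orthonormalize (D : set H) (f : H -> nat) :
    {in D &, injective f} ->
    (forall e n, orthonormal_below e n ->
       exists2 y, D y & y - proj_below e n y != 0) ->
  exists e, forall n, orthonormal_below e n /\
    forall y, D y -> (f y < n)%N -> y - proj_below e n y = 0.
Proof.
move=> f_inj Dfull.
pose res (e : nat -> H) n y := y - proj_below e n y.
pose good e n z := exists y, [/\ D y, res e n y != 0,
  forall y', D y' -> res e n y' != 0 -> (f y <= f y')%N
  & z = `|res e n y|^-1 *: res e n y].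
have good_ex e n : orthonormal_below e n -> exists z, good e n z.
  move=> /Dfull[y0 Dy0 y00].
  have exm : exists m, `[< exists y, [/\ D y, res e n y != 0 & f y = m] >].
    by exists (f y0); apply/asboolP; exists y0.
  case: (ex_minnP exm) => m /asboolP[y [Dy y_neq0 fy]] minm.
  exists (`|res e n y|^-1 *: res e n y), y; split=> // y' Dy' y'0.
  by rewrite fy minm//; apply/asboolP; exists y'.
have /choice[next nextP] (s : seq H) : exists z,
    orthonormal_below (nth 0 s) (size s) -> good (nth 0 s) (size s) z.
  have [son|?] := pselect (orthonormal_below (nth 0 s) (size s)); last by exists 0.
  by have [z] := good_ex _ _ son; exists z.
pose S n := iter n (fun s => rcons s (next s)) [::].
pose e n := next (S n).
have sizeS n : size (S n) = n by elim: n => //= n IHn; rewrite size_rcons IHn.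
have nthS n k : (k < n)%N -> nth 0 (S n) k = e k.
  elim: n => // n IHn; rewrite ltnS leq_eqVlt /= nth_rcons sizeS.
  by move=> /predU1P[->|kn]; rewrite ?ltnn ?eqxx// kn IHn.
have e_good n : orthonormal_below e n -> good e n (e n).
  move=> e_on; have := nextP (S n); rewrite sizeS.
  have projS y : res (nth 0 (S n)) n y = res e n y.
    by congr (_ - _); apply: eq_proj_below => k /nthS.
  move=> []; first by move=> i j ni nj; rewrite !nthS// e_on.
  move=> y []; rewrite projS => Dy y0 miny enE; exists y; split=> // y' Dy' y'0.
  by apply: miny; rewrite ?projS.
exists e; elim=> [|n [e_on Dn]]; first by split.
have [y [Dy y0 miny enE]] := e_good _ e_on.
have en_orth j : (j < n)%N -> '[e n, e j] = 0.
  by move=> jn; rewrite enE linearZl_LR /= inner_residual// mulr0.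
have en1 : '[e n] = 1.
  rewrite innerE enE normrZ normrV ?unitfE ?normr_eq0// normr_id mulVf ?expr1n//.
  by rewrite normr_eq0.
clearbody e; split=> [|y' Dy' y'n].
  exact: (orthonormal_belowS e_on en_orth en1).
have resS : res e n.+1 y' = res e n y' - '[res e n y', e n] *: e n.
  rewrite /res proj_belowS opprD addrA linearBl /=; congr (_ - _ *: _).
  rewrite [X in _ - X](_ : _ = 0) ?subr0//.
  rewrite /proj_below linear_sumlz /= big1// => k _.
  by rewrite linearZl_LR /= (innerC (e k)) en_orth// rmorph0 mulr0.
rewrite -/(res e n.+1 y') resS.
have [y'0|y'0] := eqVneq (res e n y') 0.
  by rewrite y'0 linear0l scale0r subr0.
(* By induction only index [n] can be left; minimality then forces [y = y'], whose residual is a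
   multiple of [e n]. *)
have fyn : f y' = n.
  apply/eqP; rewrite eqn_leq -ltnS y'n /= leqNgt; apply/negP => /(Dn _ Dy').
  by apply/eqP.
have yy' : y = y'.
  apply: f_inj; rewrite ?inE//; apply/eqP; rewrite eqn_leq miny//= fyn leqNgt.
  by apply/negP => /(Dn _ Dy); apply/eqP.
have r0 : `|res e n y| != 0 by rewrite normr_eq0.
rewrite -yy' enE linearZr_LR /= innerE conj_Creal ?rpredV ?normr_real//.
by rewrite scalerA expr2 mulKf// divff// scale1r subrr.
Qed.

Definition hilbert_basis e :=
  (forall i j, '[e i, e j] = (i == j)%:R) /\
  forall x eps, 0 < eps -> exists n, '[x - proj_below e n x] < eps.

Lemma hilbert_basis_exists : ~ finite_dimensional H -> separable H ->
  exists e, hilbert_basis e.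
Proof.
move=> infH [D cD dD]; have [f f_inj] := countable_injP _ cD.
have [|e eP] := orthonormalize f_inj.
  (* If the process stopped, a finite family would span the dense set [D], hence all of [H]. *)
  move=> e n e_on; apply: contrapT => De; apply: infH.
  exists (mkseq e n) => x; exists (fun k => '[x, e k]).
  have : x - proj_below e n x = 0.
    apply: (@dense_residual _ _ D) => // y Dy; apply: contrapT => y0.
    by apply: De; exists y => //; apply/eqP.
  move/subr0_eq => {1}->; rewrite /proj_below size_mkseq.
  by apply: eq_bigr => k _; rewrite nth_mkseq.
exists e; split=> [i j|x eps eps0].
  by have [e_on _] := eP (maxn i j).+1; rewrite e_on// ltnS ?leq_maxl ?leq_maxr.
have [y Dy xy] := dense_dnorm_lt x dD eps0.
exists (f y).+1; have [e_on De] := eP (f y).+1.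
by apply: le_lt_trans xy; apply: dnorm_residual_dist; rewrite ?De.
Qed.

End Hilbert.

(** The order of [R[i]] is only partial, so the supremum of the partial sums is taken in [R],
    through real parts. *)
Lemma nonneg_series_tail (R : realType) (a : nat -> R[i]) M (eps : R[i]) :
  (forall k, 0 <= a k) -> (forall n, \sum_(k < n) a k <= M) -> 0 < eps ->
  exists N, forall n, (N <= n)%N -> \sum_(k < n) a k - \sum_(k < N) a k < eps.
Proof.
move=> a0 aM eps0; pose A n := \sum_(k < n) a k.
have A0 n : 0 <= A n by exact: sumr_ge0.
have ARe n : (complex.Re (A n))%:C = A n by rewrite RRe_real// ger0_real.
pose E := range (fun n => complex.Re (A n)).
have supE : has_sup E.
  split; first by exists (complex.Re (A 0%N)), 0%N.
  exists (complex.Re M) => _ [n _ <-].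
  by have := aM n; rewrite lecE => /andP[_].
have epsE : (complex.Re eps)%:C = eps by rewrite RRe_real// gtr0_real.
have [|_ [N _ <-] AN] := @sup_adherent _ E (complex.Re eps) _ supE.
  by rewrite -ltcR epsE.
exists N => n _; rewrite -/(A n) -/(A N) -ARe -(ARe N) -epsE -rmorphB ltcR.
rewrite ltrBlDr -ltrBlDl (le_lt_trans _ AN)// lerB//.
by apply: ub_le_sup; [case: supE | exists n].
Qed.

(* The coordinates of [E x], where [E] is the sum of the [s^i v D u t^i], for
   [a x = '[D (u x), e _]]: the coordinate [k] unfolds the identity
   [E = v D u + s E t] at most [k] times, so that any fuel [m > k] will do. *)
Fixpoint swindle_coord (V X : Type) (z : V) (a : X -> nat -> V) (t : X -> X)
    (m : nat) (x : X) (k : nat) : V :=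
  if m isn't m'.+1 then z
  else if odd k then swindle_coord z a t m' (t x) k./2 else a x k./2.

Lemma swindle_coord_fuel (V X : Type) (z : V) (a : X -> nat -> V) (t : X -> X)
    m m' x k : (k < m)%N -> (k < m')%N ->
  swindle_coord z a t m x k = swindle_coord z a t m' x k.
Proof.
elim: m m' x k => // m IHm [//|m'] x k km km' /=.
case: ifP => // k_odd; have k2 : (k./2 < k)%N.
  by rewrite -[ltnRHS]odd_double_half k_odd -addnn ltnS leq_addr.
by apply: IHm; apply: leq_trans k2 _.
Qed.

(** * Bounded operators given by coordinates *)

Section Basis.
Context {R : realType} {H : hilbertType R} {e : nat -> H}.
Context (e_basis : hilbert_basis e).
Local Notation C := R[i].
Implicit Types (x y : H) (c : nat -> C).
Local Notation "''[' x , y ]" := (inner x y).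
Local Notation "''[' x ]" := (inner x x).

Let e_on n : orthonormal_below e n.
Proof. by move=> i j _ _; case: e_basis. Qed.

Lemma coord_le x k : `|'[x, e k]| ^+ 2 <= '[x].
Proof.
rewrite (le_trans _ (bessel x (@e_on k.+1)))// big_ord_recr /= lerDr.
by apply: sumr_ge0 => i _; rewrite exprn_ge0.
Qed.

(** Half of Parseval's identity, phrased with bounds on partial sums so that no infinite sum
    occurs. *)
Lemma parseval_le x M : (forall n, \sum_(k < n) `|'[x, e k]| ^+ 2 <= M) ->
  '[x] <= M.
Proof.
move=> xM; apply/ler_addgt0Pr => eps eps0.
have [n /ltW xn] := e_basis.2 x _ eps0.
by rewrite (pythagoras x (@e_on n)) lerD.
Qed.

Lemma coord_inj x y : (forall k, '[x, e k] = '[y, e k]) -> x = y.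
Proof.
move=> xy; apply/eqP; rewrite -subr_eq0 -(dnorm_eq0 inner) /= eq_le dnorm_ge0 andbT.
apply: parseval_le => n; rewrite big1// => k _.
by rewrite linearBl /= xy subrr normr0 expr0n.
Qed.

(** The partial sums are Cauchy by [nonneg_series_tail], and [coord_le] lets coordinates pass to the
    limit. *)
Lemma riesz_fischer c M : (forall n, \sum_(k < n) `|c k| ^+ 2 <= M) ->
  exists x, forall k, '[x, e k] = c k.
Proof.
move=> cM; pose S n := \sum_(k < n) c k *: e k.
have dist_S N n : (N <= n)%N ->
    '[S n - S N] = \sum_(k < n) `|c k| ^+ 2 - \sum_(k < N) `|c k| ^+ 2.
  move=> Nn; rewrite -(dnorm_lincomb c (@e_on n)) -/(S n) (pythagoras (S n) (@e_on N)).
  have SN (k : 'I_N) : '[S n, e k] = c k.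
    by rewrite inner_lincomb// (leq_trans _ Nn).
  have -> : proj_below e N (S n) = S N by apply: eq_bigr => k _; rewrite SN.
  have -> : \sum_(k < N) `|'[S n, e k]| ^+ 2 = \sum_(k < N) `|c k| ^+ 2.
    by apply: eq_bigr => k _; rewrite SN.
  by rewrite addrAC subrr add0r.
have /cauchy_cvg S_cvg : cauchy (S @ \oo).
  apply: cauchy_exP => eps eps0.
  have [|||N NP] := @nonneg_series_tail _ (fun k => `|c k| ^+ 2) M (eps ^+ 2).
  - by move=> k; rewrite exprn_ge0.
  - exact: cM.
  - by rewrite exprn_gt0.
  exists (S N); exists N => // n /= Nn; rewrite -ball_normE /= distrC.
  rewrite -(@ltr_pXn2r _ 2) ?nnegrE ?(ltW eps0)// -innerE.
  by rewrite dist_S// NP.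
exists (lim (S @ \oo)) => k; apply/eqP; rewrite -subr_eq0 -normr_eq0 -sqrf_eq0.
rewrite eq_le exprn_ge0// andbT; apply/ler_addgt0Pr => eps eps0; rewrite add0r.
have sqeps0 : 0 < sqrtC eps by rewrite sqrtC_gt0.
have [n [xn kn]] : exists n, `|lim (S @ \oo) - S n| < sqrtC eps /\ (k < n)%N.
  apply: (@filter_ex _ \oo); apply: filterI; last exact: nbhs_infty_gt.
  by move: S_cvg => /cvgrPdist_lt /(_ _ sqeps0).
rewrite -(inner_lincomb c (@e_on n) kn) -linearBl /= (le_trans (coord_le _ _))//.
by rewrite innerE -[eps]sqrtCK lerXn2r ?nnegrE ?sqrtC_ge0 ?(ltW eps0)// ltW.
Qed.

Lemma bop_linear (T : bop H) : linear T.
Proof. by case/bounded_operatorP: (bop_subproof T). Qed.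

Lemma bop_dnorm_le (T : bop H) : exists2 M, 0 <= M & forall x, '[T x] <= M * '[x].
Proof.
have /bounded_operatorP[_ [K TK]] := bop_subproof T.
exists (`|K| ^+ 2) => [|x]; first by rewrite exprn_ge0.
rewrite !innerE -exprMn lerXn2r ?nnegrE ?mulr_ge0// (le_trans (TK x))//.
have Kx0 : 0 <= K * `|x| by apply: le_trans (TK x).
by rewrite -[in leRHS](normr_id x) -normrM ger0_norm.
Qed.

Lemma bop_of_coords (Phi : H -> nat -> C) M : 0 <= M ->
  (forall k a x y, Phi (a *: x + y) k = a * Phi x k + Phi y k) ->
  (forall x n, \sum_(k < n) `|Phi x k| ^+ 2 <= M * '[x]) ->
  exists T : bop H, forall x k, '[T x, e k] = Phi x k.
Proof.
move=> M0 PhiL PhiM.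
have /choice[T TPhi] x : exists y, forall k, '[y, e k] = Phi x k.
  exact: riesz_fischer (PhiM x).
suff T_bop : T \in bounded_operator by exists (Bop T_bop).
apply/bounded_operatorP; split=> [a x y|].
  by apply: coord_inj => k; rewrite linearDl /= linearZl_LR /= !TPhi PhiL.
exists (sqrtC M) => x.
rewrite -(@ler_pXn2r _ 2) ?nnegrE ?mulr_ge0 ?sqrtC_ge0// exprMn sqrtCK -!innerE.
apply: parseval_le => n; rewrite (eq_bigr (fun k : 'I_n => `|Phi x k| ^+ 2)).
  exact: PhiM.
by move=> k _; rewrite TPhi.
Qed.

Lemma sum_double (V : nmodType) (F : nat -> V) n :
  \sum_(k < n.*2) F k = \sum_(k < n) (F k.*2 + F k.*2.+1).
Proof.
elim: n => [|n IHn]; first by rewrite !big_ord0.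
by rewrite doubleS !big_ord_recr /= IHn addrA.
Qed.

Lemma coords_even_odd x n :
  \sum_(k < n) `|'[x, e k.*2]| ^+ 2 + \sum_(k < n) `|'[x, e k.*2.+1]| ^+ 2 <= '[x].
Proof.
rewrite -big_split /= -(sum_double (fun k => `|'[x, e k]| ^+ 2)).
exact: bessel.
Qed.

Lemma interleave_le (a b : nat -> C) n :
  \sum_(k < n) `|if odd k then b k./2 else a k./2| ^+ 2
  <= \sum_(k < n) `|a k| ^+ 2 + \sum_(k < n) `|b k| ^+ 2.
Proof.
apply: (@le_trans _ _ (\sum_(k < n.*2) `|if odd k then b k./2 else a k./2| ^+ 2)).
  rewrite -addnn big_split_ord /= lerDl.
  by apply: sumr_ge0 => k _; rewrite exprn_ge0.
rewrite (sum_double (fun k => `|if odd k then b k./2 else a k./2| ^+ 2)).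
rewrite -big_split /= ler_sum// => k _.
by rewrite /= odd_double /= doubleK uphalf_double.
Qed.

(** The limits for [x] and [y] are taken one after the other, with the two truncations compared at
    their maximum. *)
Lemma dnormD_le x y (z : H) :
  (forall n, \sum_(k < n) `|'[x, e k]| ^+ 2
             + \sum_(k < n) `|'[y, e k]| ^+ 2 <= '[z]) ->
  '[x] + '[y] <= '[z].
Proof.
move=> xyz; rewrite -lerBrDr; apply: parseval_le => n.
rewrite lerBrDr addrC -lerBrDr; apply: parseval_le => m.
rewrite lerBrDr addrC (le_trans _ (xyz (maxn m n)))//.
have sum_mono w i j : (i <= j)%N ->
    \sum_(k < i) `|'[w, e k]| ^+ 2 <= \sum_(k < j) `|'[w, e k]| ^+ 2.
  move=> ij; rewrite -(subnKC ij) big_split_ord /= lerDl.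
  by apply: sumr_ge0 => k _; rewrite exprn_ge0.
by rewrite lerD// sum_mono ?leq_maxl ?leq_maxr.
Qed.

(** In coordinates, [u] and [t] extract the even and the odd ones, while [v] and [s] put a sequence
    back at the even or odd places. *)
Lemma splitting_exists : exists u v s t : bop H, splitting u v s t /\
  forall D, exists E, E = v * D * u + s * E * t.
Proof.
have bopP (S T : bop H) : (forall x k, '[S x, e k] = '[T x, e k]) -> S = T.
  move=> ST; apply: val_inj; apply: funext => x; apply: coord_inj => k.
  exact: ST.
have [u uE] : exists u : bop H, forall x k, '[u x, e k] = '[x, e k.*2].
  apply: (@bop_of_coords _ 1) => [//|k a x y|x n].
    by rewrite linearDl /= linearZl_LR.
  rewrite mul1r (le_trans _ (coords_even_odd x n))// lerDl.
  by apply: sumr_ge0 => k _; rewrite exprn_ge0.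
have [t tE] : exists t : bop H, forall x k, '[t x, e k] = '[x, e k.*2.+1].
  apply: (@bop_of_coords _ 1) => [//|k a x y|x n].
    by rewrite linearDl /= linearZl_LR.
  rewrite mul1r (le_trans _ (coords_even_odd x n))// lerDr.
  by apply: sumr_ge0 => k _; rewrite exprn_ge0.
have [v vE] : exists v : bop H, forall x k,
    '[v x, e k] = if odd k then 0 else '[x, e k./2].
  apply: (@bop_of_coords _ 1) => [//|k a x y|x n].
    by case: ifP => _; rewrite ?mulr0 ?addr0// linearDl /= linearZl_LR.
  rewrite mul1r (le_trans (interleave_le (fun k => '[x, e k]) (fun=> 0) n))//.
  rewrite [X in _ + X]big1 ?addr0 ?bessel// => k _.
  by rewrite normr0 expr0n.
have [s sE] : exists s : bop H, forall x k,
    '[s x, e k] = if odd k then '[x, e k./2] else 0.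
  apply: (@bop_of_coords _ 1) => [//|k a x y|x n].
    by case: ifP => _; rewrite ?mulr0 ?addr0// linearDl /= linearZl_LR.
  rewrite mul1r (le_trans (interleave_le (fun=> 0) (fun k => '[x, e k]) n))//.
  rewrite big1 ?add0r ?bessel// => k _.
  by rewrite normr0 expr0n.
have utE x : '[u x] + '[t x] <= '[x].
  apply: dnormD_le => n; apply: le_trans (coords_even_odd x n).
  by under eq_bigr do rewrite uE; under [X in _ + X <= _]eq_bigr do rewrite tE.
exists u, v, s, t; split.
  split; apply: bopP => x k /=.
  - by rewrite uE vE odd_double doubleK.
  - by rewrite tE sE /= odd_double /= uphalf_double.
  - by rewrite uE sE odd_double linear0l.
  - by rewrite tE vE /= odd_double linear0l.
  - rewrite linearDl /= vE sE uE tE.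
    by rewrite -[in RHS](odd_double_half k); case: odd; rewrite ?add0r ?addr0.
move=> D; have [M M0 DM] := bop_dnorm_le D.
pose Phi := swindle_coord (0 : C) (fun x k => '[D (u x), e k]) t.
have PhiS m x k :
    Phi m.+1 x k = if odd k then Phi m (t x) k./2 else '[D (u x), e k./2].
  by [].
have Phi_linear m k a x y : Phi m (a *: x + y) k = a * Phi m x k + Phi m y k.
  elim: m k x y => [|m IHm] k x y; first by rewrite mulr0 addr0.
  rewrite !PhiS; case: ifP => _; first by rewrite bop_linear IHm.
  by rewrite !bop_linear linearDl /= linearZl_LR.
(* The bound does not depend on the fuel: [D (u x)] costs [M * '[u x]], the recursive part [M *
   '[t x]], and [utE] adds the two up. *)
have Phi_le m x n : \sum_(k < n) `|Phi m x k| ^+ 2 <= M * '[x].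
  elim: m x n => [|m IHm] x n.
    rewrite big1 => [|k _]; last by rewrite normr0 expr0n.
    by rewrite mulr_ge0 ?dnorm_ge0.
  rewrite (le_trans (interleave_le (fun k => '[D (u x), e k]) (Phi m (t x)) n))//.
  rewrite (le_trans _ (ler_wpM2l M0 (utE x)))// mulrDr lerD//.
  by rewrite (le_trans _ (DM _))// bessel.
have [E EE] : exists E : bop H, forall x k, '[E x, e k] = Phi k.+1 x k.
  apply: (bop_of_coords M0) => [k a x y|x n]; first exact: Phi_linear.
  rewrite (eq_bigr (fun k : 'I_n => `|Phi n x k| ^+ 2)) ?Phi_le// => k _.
  by rewrite /Phi (@swindle_coord_fuel _ _ _ _ _ _ n).
exists E; apply: bopP => x k; rewrite linearDl /= vE sE !EE.
rewrite PhiS; case: ifP => k_odd; rewrite ?addr0// add0r.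
(* One side has fuel [k], the other [(k./2).+1]; both exceed [k./2] because [k] is odd. *)
apply: swindle_coord_fuel => //.
by rewrite -[ltnRHS]odd_double_half k_odd -addnn ltnS leq_addr.
Qed.

End Basis.

Theorem theorem4p2 (R : realType) (H : hilbertType R)
    (H_infinite : ~ finite_dimensional H) (H_separable : separable H)
    (f : ncpoly R) (f_nonconstant : nonconstant f) (T : bop H) :
  exists n : nat, (1 <= n <= 8)%N /\
    exists S : 'I_n -> bop H,
      (forall k, ncimage f (S k)) /\ T = \sum_(k < n) S k.
Proof.
have [e e_basis] := hilbert_basis_exists H_infinite H_separable.
have [u [v [s [t [uvst swindle]]]]] := splitting_exists e_basis.
pose c : bop H := monalg.mcoeff monalg.one f *: (1 : bop H).
(* Each of the eight values will contribute the constant term [c] once, so these are subtracted in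
   advance. *)
have [N [N_roomy TN]] := sum_eight_roomy uvst swindle (T - c *+ 8).
exists 8; split=> //; exists (fun k => c + N k); split=> [k|].
  exact: ncimage_roomy uvst f_nonconstant (N_roomy k).
by rewrite big_split /= -TN sumr_const card_ord addrC subrK.
Qed.
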